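(* For the online Submodular Welfare Maximization problem in the random order model in which every agent's valuation function is second-order supermodular, the Greedy algorithm has competitive ratio at least $0.5104$.
   Context: Online SWM: a set $N$ of $n$ items and $m$ agents; agent $\ell$ has a monotone submodular valuation $v_\ell:2^N\to\mathbb{R}_{\ge0}$ with $v_\ell(\emptyset)=0$. Items arrive one at a time in a uniformly random order and each must be irrevocably assigned to an agent upon arrival; welfare is $\sum_\ell v_\ell(S_\ell)$ and $\mathrm{OPT}$ is the maximum welfare of a partition of $N$. Greedy assigns each arriving item $j$ to an agent maximizing $v_\ell(S_\ell\cup\{j\})-v_\ell(S_\ell)$ with $S_\ell$ the current set of $\ell$. Competitive ratio: infimum over instances of $\mathbb{E}[\text{Greedy welfare}]/\mathrm{OPT}$. For a set function $f$, let $MG(A,e)=f(A\cup\{e\})-f(A)$. A submodular $f$ is second-order supermodular if for all sets $A\subseteq B$, all $S$ with $S\cap B=\emptyset$, and all elements $e$: $MG(A,e)-MG(A\cup S,e)\ \ge\ MG(B,e)-MG(B\cup S,e)$. *)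

(* Defs.v *)
From HB Require Import structures.
From mathcomp Require Import all_boot all_order all_algebra all_fingroup.
From mathcomp Require Import boolp classical_sets reals.

Set Implicit Arguments.
Unset Strict Implicit.
Unset Printing Implicit Defensive.

Import Order.TTheory GRing.Theory Num.Theory.

Local Open Scope ring_scope.

Section SetFunctions.
Context {R : realType} {N : finType}.
Implicit Types (f : {set N} -> R) (A B S : {set N}) (e : N).

Definition MG f A e : R := f (e |: A) - f A.

Definition monotone f := forall A B, A \subset B -> f A <= f B.

Definition submodular f :=
  forall A B, f (A :|: B) + f (A :&: B) <= f A + f B.

Definition valuation f :=
  [/\ forall A, 0 <= f A, f finset.set0 = 0, monotone f & submodular f].

(* Only ever used for an f that is also a [valuation], hence submodular. *)
Definition second_order_supermodular f :=
  forall A B S e, A \subset B -> [disjoint S & B] ->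
    MG f B e - MG f (B :|: S) e <= MG f A e - MG f (A :|: S) e.

End SetFunctions.

Section Welfare.
Context {R : realType} {N M : finType}.
Variable v : M -> {set N} -> R.

Definition welfare (S : M -> {set N}) : R := \sum_l v l (S l).

(* A partition of N into one, possibly empty, bundle per agent is given by the
   function sending each item to its agent.  The default value 0 is harmless,
   valuations being nonnegative. *)
Definition OPT : R :=
  \big[Num.max/0]_(a : {ffun N -> M}) welfare (fun l => [set j | a j == l]).

(* A deterministic online assignment rule: [alg h j] is the agent who receives
   the arriving item j when h is the list of earlier items, in order of
   arrival.  Earlier decisions are determined by the prefixes of h. *)
Definition online_rule := seq N -> N -> M.

Definition bundle (alg : online_rule) (s : seq N) (l : M) : {set N} :=
  [set j in s | alg (take (index j s) s) j == l].

(* Ties may be broken arbitrarily, even depending on the whole history. *)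
Definition greedy (alg : online_rule) :=
  forall (h : seq N) (j : N), uniq (rcons h j) ->
    forall l : M, MG (v l) (bundle alg h l) j
                  <= MG (v (alg h j)) (bundle alg h (alg h j)) j.

Definition expected_welfare (alg : online_rule) : R :=
  (\sum_(s : {perm N}) welfare (bundle alg [seq s i | i <- enum N]))
    / #|{perm N}|%:R.

End Welfare.

(* The infimum of E[Greedy]/OPT over the instances whose valuations lie in the
   class C, and over all tie-breaking rules.  Instances with OPT = 0, for which
   the ratio is undefined, are left out. *)
Definition greedy_competitive_ratio (R : realType)
    (C : forall N : finType, ({set N} -> R) -> Prop) : R :=
  inf (fun r : R => exists (N M : finType) (v : M -> {set N} -> R)
                           (alg : online_rule),
    [/\ forall l, valuation (v l) /\ C N (v l),
        greedy v alg,
        0 < OPT v &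
        r = expected_welfare v alg / OPT v]).

(* Main.v *)
Require Import Defs.
From mathcomp Require Import all_boot all_order all_algebra all_fingroup.
From mathcomp Require Import reals.
From mathcomp Require Import zify ring lra.

(**
Write the assignment as a set of pairs (item, agent), so that the welfare is a
single monotone submodular second-order supermodular function f on pairs.  Fix
an allocation o and let D_j(S) be the marginal of the pair o_j over S.  For a
random order let A_p be the pairs chosen in the first p of n steps, g_p the mean
of f(A_p), x_p the mean of D_j(A_p) for an item j that has not yet arrived, and
X_p = x_0 + ... + x_{p-1}.  Greedy gives g_{p+1} - g_p >= x_p, x is decreasing,
and f(o) <= f(A_p) + sum_j D_j(A_p) gives f(o) <= g_p + X_p + (n - p) x_p, hence
g_p + X_p >= (1 - (1 - p/n)^2) f(o).  This only yields g_n >= f(o)/2, and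
equality would force the items arriving after j not to damage D_j any more.

Second-order supermodularity excludes this.  Split a random order as K J with
|J| = n/4, run Greedy on K, and cut its choices into C_0, C_1, C_2 according to
the position modulo 3.  For each r the order made of J, then K without the
residue class r in reverse, then the residue class r, is again uniform; in it
the items of the class arrive last, so they gain little, and therefore f(C_r | A)
is at most g_n - g_{3n/4}.  Thus C_r damages little the items that arrived early.
But the damage to o_j over a fixed set Y is subadditive in the damaging set, so
the damages of C_0, C_1 and C_2 add up to at least that of the whole run on K,
which is large.  Summing the three inequalities and using the bounds on g + X at
a few points gives g_n >= 0.5106 f(o) in the limit; adding worthless items makes
n as large (and as divisible) as needed.
*)

Set Implicit Arguments.
Unset Strict Implicit.
Unset Printing Implicit Defensive.

Import Order.TTheory GRing.Theory Num.Theory.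

Local Open Scope ring_scope.

(** * Marginals of submodular and second-order supermodular functions *)

Section Valuation.
Context {R : realType} {T : finType} {f : {set T} -> R}.
Hypothesis f_val : valuation f.
Implicit Types (A B C D Y : {set T}) (e : T).

Lemma MG_ge0 A e : 0 <= MG f A e.
Proof. by case: f_val => _ _ fM _; rewrite /MG subr_ge0 fM // subsetUr. Qed.

Lemma MG_mem A e : e \in A -> MG f A e = 0.
Proof.
move=> eA; rewrite /MG (_ : e |: A = A) ?subrr //.
by apply/setUidPr; rewrite sub1set.
Qed.

Lemma MG_anti A B e : A \subset B -> MG f B e <= MG f A e.
Proof.
move=> sAB; have [eB|eB] := boolP (e \in B); first by rewrite MG_mem ?MG_ge0.
case: f_val => _ _ _ /(_ (e |: A) B).
rewrite -setUA (setUidPr sAB) setIUl (setIidPl sAB).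
have -> : [set e] :&: B = finset.set0 by apply/disjoint_setI0; rewrite disjoints1.
by rewrite set0U /MG; lra.
Qed.

Lemma le_setU_seq A (cs : seq T) :
  f (A :|: [set:: cs]) <= f A + \sum_(c <- cs) MG f A c.
Proof.
elim: cs => [|c cs IH]; first by rewrite set_nil setU0 big_nil addr0.
rewrite big_cons set_cons setUCA.
have := @MG_anti A (A :|: [set:: cs]) c (subsetUl _ _).
rewrite {1}/MG; lra.
Qed.

Hypothesis f_sos : second_order_supermodular f.

(** Damages to [e] over [Y] are subadditive: [D] does no more damage over [Y :|: C] than over [Y].
    The hypothesis is applied to [D] minus [Y :|: C] to get disjointness, and [MG_anti] restores the
    full [D]. *)
Lemma MG_setU2 Y C D e :
  MG f (Y :|: C) e + MG f (Y :|: D) e <= MG f Y e + MG f (Y :|: C :|: D) e.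
Proof.
have dS : [disjoint D :\: (Y :|: C) & Y :|: C].
  by rewrite -setI_eq0 setIDAC setDE -setIA setICr setI0.
have := @f_sos Y (Y :|: C) (D :\: (Y :|: C)) e (subsetUl _ _) dS.
have -> : Y :|: C :|: (D :\: (Y :|: C)) = Y :|: C :|: D.
  by apply/setP => z; rewrite !inE; do !case: (z \in _).
have := @MG_anti (Y :|: (D :\: (Y :|: C))) (Y :|: D) e (setUS _ (subsetDl _ _)).
lra.
Qed.

End Valuation.

(** * Relabelling invariance of the uniformly random order *)

Section RandomOrder.
Context {R : realType} {N : finType}.

Lemma exists_perm_map (u w : seq N) : uniq u -> uniq w -> size u = size w ->
  exists s : {perm N}, map s u = w.
Proof.
elim/last_ind: u w => [|u a IH] w.
  by move=> _ _ /esym/size0nil->; exists 1%g.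
case/lastP: w => [|w b]; first by rewrite size_rcons.
rewrite !rcons_uniq !size_rcons => /andP[au uu] /andP[bw uw] [suw].
have [s sE] := IH w uu uw suw.
exists (s * tperm (s a) b)%g; rewrite map_rcons permM tpermL; congr rcons.
rewrite -sE -[RHS]map_id -map_comp; apply/eq_in_map => c cu /=.
rewrite permM tpermD // -?sE; first by apply: contraNneq au => /perm_inj->.
by apply: contraNneq bw => ->; rewrite -sE map_f.
Qed.

(** Some permutation [p] maps [u] to [w], and multiplication by [p] permutes the summation range.
    All uses of the random order rest on this exchangeability. *)
Lemma sum_perm_map (F : seq N -> R) (u w : seq N) :
  uniq u -> uniq w -> size u = size w ->
  \sum_(s : {perm N}) F (map s u) = \sum_(s : {perm N}) F (map s w).
Proof.
move=> uu uw /(exists_perm_map uu uw)[p <-].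
rewrite (reindex_inj (mulgI p)); apply: eq_bigr => s _.
by rewrite -map_comp; congr F; apply: eq_map => c /=; rewrite permM.
Qed.

End RandomOrder.

(** * Choices made by an online rule along an order *)

Section Run.
Context {N T : finType} (x0 : N) (ch : seq N -> N -> T).
Implicit Types (t : seq N) (r p q : nat).

(** [ch h j] is the ground-set element picked for item [j] after history [h]; in the application it
    is an item-agent pair. *)
Definition choice t i : T := ch (take i t) (nth x0 t i).

Definition run t : {set T} := [set:: [seq choice t i | i <- iota 0 (size t)]].

(* Meant for [3 %| size t]: an incomplete last triple is ignored. *)
Definition run_mod3 r t : {set T} :=
  [set:: [seq choice t (3 * k + r) | k <- iota 0 (size t %/ 3)]].

Lemma runP t c :
  reflect (exists2 i, (i < size t)%N & c = choice t i) (c \in run t).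
Proof.
rewrite inE; apply: (iffP mapP) => -[i]; rewrite ?mem_iota => *; exists i => //.
by rewrite mem_iota.
Qed.

Lemma run_mod3P r t c :
  reflect (exists2 k, (k < size t %/ 3)%N & c = choice t (3 * k + r))
          (c \in run_mod3 r t).
Proof.
rewrite inE; apply: (iffP mapP) => -[i]; rewrite ?mem_iota => *; exists i => //.
by rewrite mem_iota.
Qed.

Lemma choice_take t p i : (i < p)%N -> choice (take p t) i = choice t i.
Proof. by move=> ip; rewrite /choice nth_take // take_takel // ltnW. Qed.

Lemma run_rcons t j : run (rcons t j) = ch t j |: run t.
Proof.
apply/setP=> c; rewrite in_setU1; apply/runP/orP.
  case=> i; rewrite size_rcons ltnS leq_eqVlt => /orP[/eqP->|it] ->.
    by left; rewrite /choice -cats1 take_size_cat // nth_cat ltnn subnn.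
  right; apply/runP; exists i => //.
  by rewrite /choice -cats1 takel_cat ?(ltnW it) // nth_cat it.
case=> [/eqP->|/runP[i it ->]].
  exists (size t); first by rewrite size_rcons.
  by rewrite /choice -cats1 take_size_cat // nth_cat ltnn subnn.
exists i; first by rewrite size_rcons ltnS ltnW.
by rewrite /choice -cats1 takel_cat ?(ltnW it) // nth_cat it.
Qed.

Lemma run_take_sub t p q : (p <= q)%N -> run (take p t) \subset run (take q t).
Proof.
move=> pq; apply/subsetP=> c /runP[i]; rewrite size_take_min leq_min => /andP[ip it] ->.
apply/runP; exists i; first by rewrite size_take_min leq_min it (leq_trans ip).
by rewrite !choice_take // (leq_trans ip).
Qed.

Lemma run_take_subT t p : run (take p t) \subset run t.
Proof.
have [pt|/ltnW tp] := leqP p (size t); last by rewrite take_oversize.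
by rewrite -{2}(take_size t); apply: run_take_sub.
Qed.

Lemma run_mod3_take_sub r t p : (r < 3)%N -> (3 %| p)%N ->
  run_mod3 r (take p t) \subset run_mod3 r t.
Proof.
move=> r3 p3; apply/subsetP=> c /run_mod3P[k]; rewrite size_take_min => kp ->.
apply/run_mod3P; exists k; first by move: kp p3; lia.
by rewrite choice_take //; move: kp p3; lia.
Qed.

Lemma run_sub_mod3 t : (3 %| size t)%N ->
  run t \subset run_mod3 0 t :|: run_mod3 1 t :|: run_mod3 2 t.
Proof.
move=> t3; apply/subsetP=> c /runP[i it ->].
have ik : (i %/ 3 < size t %/ 3)%N by move: it t3; lia.
have : (i %% 3 < 3)%N by rewrite ltn_mod.
have : i = (3 * (i %/ 3) + i %% 3)%N by lia.
move: (i %% 3)%N => r -> /=.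
case: r => [|[|[|//]]] _; rewrite !in_setU; apply/orP;
  [left; apply/orP; left|left; apply/orP; right|right];
  apply/run_mod3P; eexists; eauto.
Qed.

End Run.

(** * Greedy against a fixed allocation: growth of value and decay of marginals *)

Section Greedy.
Context {R : realType} {N T : finType} (x0 : N) {f : {set T} -> R}.
Context {ch : seq N -> N -> T} {o : N -> T}.
Hypothesis f_val : valuation f.
Hypothesis f_sos : second_order_supermodular f.
Local Notation run := (run x0 ch).
Local Notation run_mod3 := (run_mod3 x0 ch).
(** Greedy enters only through two comparisons: with the reference allocation, and with what another
    history would have picked for the same item. *)
Hypothesis greedy_opt : forall h j, uniq (rcons h j) ->
  MG f (run h) (o j) <= MG f (run h) (ch h j).
Hypothesis greedy_alt : forall h h' j, uniq (rcons h j) ->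
  MG f (run h) (ch h' j) <= MG f (run h) (ch h j).

Local Notation n := #|N|.
Local Notation e := (enum N).
Local Notation e_ := (nth x0 e).

(* Expectations over the random order are kept as unnormalized sums over all
   permutations. *)
Definition total_opt : R := \sum_(s : {perm N}) f [set o j | j : N].

Definition total_value p : R := \sum_(s : {perm N}) f (run (map s (take p e))).

Definition total_marginal p : R :=
  \sum_(s : {perm N}) MG f (run (map s (take p e))) (o (s (e_ p))).

Local Notation Q := total_opt.
Local Notation g := total_value.
Local Notation x := total_marginal.
Local Notation X p := (\sum_(0 <= i < p) x i).

Lemma size_e : size e = n. Proof. by rewrite -cardE. Qed.

Lemma uniq_rcons_take p q : (p <= q < n)%N -> uniq (rcons (take p e) (e_ q)).
Proof.
move=> /andP[pq qn]; rewrite rcons_uniq take_uniq ?enum_uniq // andbT.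
apply/negP => /(nthP x0)[i]; rewrite size_take_min size_e leq_min => /andP[ip iN].
rewrite nth_take // => /eqP; rewrite nth_uniq ?size_e ?enum_uniq //.
by move/eqP=> iq; move: ip pq; rewrite iq; lia.
Qed.

Lemma total_valueE t : uniq t ->
  \sum_(s : {perm N}) f (run (map s t)) = g (size t).
Proof.
move=> ut; rewrite /g; apply: (@sum_perm_map _ _ (fun w => f (run w))) => //.
  by rewrite take_uniq ?enum_uniq.
rewrite size_take_min size_e; apply/esym/minn_idPl.
by rewrite -(card_uniqP ut) max_card.
Qed.

Lemma total_marginalE t j : uniq (rcons t j) ->
  \sum_(s : {perm N}) MG f (run (map s t)) (o (s j)) = x (size t).
Proof.
move=> ut; have tn : (size t < n)%N.
  by rewrite -(size_rcons t j) -(card_uniqP ut) max_card.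
pose F w := MG f (run (take (size t) w)) (o (nth x0 w (size t))).
have FE u i : size u = size t -> \sum_(s : {perm N}) MG f (run (map s u)) (o (s i))
    = \sum_(s : {perm N}) F (map s (rcons u i)).
  move=> su; apply: eq_bigr => s _.
  rewrite /F map_rcons -cats1 -su take_size_cat ?size_map //.
  by rewrite nth_cat size_map ltnn subnn.
rewrite FE // /x FE; last by rewrite size_take_min size_e; apply/minn_idPl/ltnW.
apply: sum_perm_map => //; first by rewrite uniq_rcons_take // leqnn.
by rewrite !size_rcons size_take_min size_e; congr _.+1; apply/esym/minn_idPl/ltnW.
Qed.

(** After the first [p] items, all items still to come are exchangeable. *)
Lemma total_marginal_late p q : (p <= q < n)%N ->
  \sum_(s : {perm N}) MG f (run (map s (take p e))) (o (s (e_ q))) = x p.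
Proof.
move=> pq; rewrite total_marginalE ?uniq_rcons_take // size_take_min size_e.
by congr x; lia.
Qed.

Lemma total_marginal_ge0 p : 0 <= x p.
Proof. by apply: sumr_ge0 => s _; apply: MG_ge0. Qed.

Lemma total_marginal_anti p q : (p <= q < n)%N -> x q <= x p.
Proof.
move=> pq; rewrite -(total_marginal_late pq); apply: ler_sum => s _.
by apply: MG_anti => //; rewrite !map_take; apply: run_take_sub; lia.
Qed.

Lemma total_value_step p : (p < n)%N -> x p <= g p.+1 - g p.
Proof.
move=> pn; rewrite -sumrB; apply: ler_sum => s _.
rewrite (take_nth x0) ?size_e // map_rcons run_rcons; apply: greedy_opt.
by rewrite -map_rcons map_inj_uniq ?uniq_rcons_take ?leqnn //; apply: perm_inj.
Qed.

Lemma total_value_ge0 p : 0 <= g p.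
Proof. by apply: sumr_ge0 => s _; case: f_val. Qed.

Lemma sum_marginal_le_value p q : (p <= q <= n)%N -> X q - X p <= g q - g p.
Proof.
move=> /andP[pq qn]; rewrite (big_cat_nat (leq0n p) pq) /= addrAC subrr add0r.
have <- := telescope_sumr g pq.
rewrite !big_nat; apply: ler_sum => i /andP[_ iq].
by apply: total_value_step; apply: leq_trans qn.
Qed.

Lemma opt_le_cover (S : {set T}) (z : seq N) : uniq z -> size z = n ->
  f [set o j | j : N] <= f S + \sum_(0 <= p < n) MG f S (o (nth x0 z p)).
Proof.
move=> uz sz; apply: (@le_trans _ _ (f (S :|: [set:: map o z]))).
  case: f_val => _ _ fM _; apply: fM.
  apply/subsetP => c /imsetP[j _ ->]; rewrite !inE map_f ?orbT //.
  have sze : {subset z <= e} by move=> i _; rewrite mem_enum.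
  by rewrite (uniq_min_size uz sze _).2 ?mem_enum // sz size_e.
apply: le_trans (le_setU_seq f_val _ _) _.
by rewrite big_map -sz -(big_nth x0 xpredT (fun j => MG f S (o j))).
Qed.

(** The run so far and the marginals over it cover the optimum. An item that arrived at time [i < p]
    contributes at most its marginal [x i] at arrival; each of the [n - p] others contributes
    [x p]. *)
Lemma potential p : (p < n)%N -> Q <= g p + X p + (n - p)%:R * x p.
Proof.
move=> pn; apply: (@le_trans _ _ (\sum_(s : {perm N}) (f (run (map s (take p e)))
    + \sum_(0 <= i < n) MG f (run (map s (take p e))) (o (s (e_ i)))))).
  apply: ler_sum => s _.
  have /opt_le_cover-/(_ (run (map s (take p e)))) : uniq (map s e).
    by rewrite map_inj_uniq ?enum_uniq //; apply: perm_inj.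
  rewrite size_map size_e => /(_ erefl) /le_trans; apply; rewrite lerD2l.
  rewrite !big_nat; apply: ler_sum => i /andP[_ iN].
  by rewrite (nth_map x0) ?size_e.
rewrite big_split /= exchange_big /= -addrA lerD2l.
rewrite (big_cat_nat (leq0n p) (ltnW pn)) /=; apply: lerD.
  rewrite !big_nat; apply: ler_sum => i /andP[_ ip]; apply: ler_sum => s _.
  by apply: MG_anti => //; rewrite !map_take; apply: run_take_sub; lia.
rewrite big_nat (eq_bigr (fun=> x p)); last by move=> i; apply: total_marginal_late.
by rewrite -big_nat sumr_const_nat mulr_natl.
Qed.

(** A step raises [g + X] by at least [2 * x p], and [potential] bounds [x p] below by the gap over
    [n - p]. So the gap to [Q] shrinks by a factor [1 - 2 / (n - p)], and these factors
    telescope. *)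
Lemma potential_lb p : (p <= n)%N -> (1 < n)%N ->
  Q * (1 - ((n - p)%:R / n%:R) ^+ 2) <= g p + X p.
Proof.
move=> pn n1; have n0 : 0 < n%:R :> R by rewrite ltr0n; lia.
have Q0 : 0 <= Q by apply: sumr_ge0 => s _; case: f_val.
(* The sharper bound with m(m - 1) for m^2 is the one that is inductive. *)
suff H : (Q - (g p + X p)) * (n%:R * (n%:R - 1)) <= Q * ((n - p)%:R * ((n - p)%:R - 1)).
  have mn : (n - p)%:R <= n%:R :> R by rewrite ler_nat leq_subr.
  have m0 : 0 <= (n - p)%:R :> R by [].
  have n1' : 0 < n%:R - 1 :> R by rewrite subr_gt0 ltr1n.
  move: H n0 mn m0 n1'; move: (n - p)%:R n%:R (g p + X p) => m k y H k0 mk m0 k1.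
  suff : (Q - y) * k ^+ 2 <= Q * m ^+ 2.
    rewrite -ler_pdivlMr ?exprn_gt0 // => Hy.
    rewrite mulrBr mulr1 expr_div_n mulrA; lra.
  rewrite -(ler_pM2r k1); apply: (@le_trans _ _ (Q * (m * (m - 1)) * k)).
    rewrite -(ler_pM2r k0) in H; apply: le_trans H.
    by rewrite le_eqVlt; apply/orP; left; apply/eqP; ring.
  rewrite -mulrA -[leRHS]mulrA ler_wpM2l //.
  rewrite -subr_ge0 (_ : _ - _ = m * (k - m)); last by ring.
  by rewrite mulr_ge0 // subr_ge0.
elim: p pn => [|p IH] pn.
  rewrite subn0 big_nil addr0 ler_wpM2r //.
    by rewrite mulr_ge0 ?ler0n // subr_ge0 ler1n; lia.
  by rewrite gerBl total_value_ge0.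
have /IH {}IH := ltnW pn.
have := potential pn; have := total_value_step pn.
rewrite big_nat_recr //= -(subnSK pn) -[(n - p.+1).+1]addn1 natrD in IH *.
set m := (n - p.+1)%:R in IH *.
have m0 : 0 <= m by [].
have k0 : 0 <= n%:R * (n%:R - 1) :> R.
  by rewrite mulr_ge0 ?ler0n // subr_ge0 ler1n; lia.
move: k0 IH; move: (n%:R * (n%:R - 1)) => k k0 IH H1 H2.
have H3 : (Q - (g p.+1 + (X p + x p))) <= Q - (g p + X p) - 2%:R * x p by lra.
(* The factor [m - 1] is nonnegative except at the last step [m = 0], where the gap itself becomes
   nonpositive. *)
have [m00|mN] := eqVneq m 0; last first.
  have mP : 0 < m + 1 by lra.
  rewrite -(ler_pM2l mP).
  apply: (@le_trans _ _ ((Q - (g p + X p)) * k * (m - 1))).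
    rewrite [leLHS]mulrA [leRHS]mulrAC ler_wpM2r //; nra.
  apply: (@le_trans _ _ (Q * ((m + 1) * (m + 1 - 1)) * (m - 1))); last first.
    by rewrite le_eqVlt; apply/orP; left; apply/eqP; ring.
  apply: ler_wpM2r IH; rewrite subr_ge0 /m ler1n.
  by rewrite lt0n; apply: contraNneq mN; rewrite /m => ->.
have := total_marginal_ge0 p; move: H2; rewrite m00 add0r mul1r => H2 x_ge0.
by rewrite mul0r mulr0 mulr_le0_ge0 //; lra.
Qed.

(** * Reordered runs in which one residue class arrives last *)

Section Reordering.
Variables v B : nat.
Hypothesis nE : n = (v + 3 * B)%N.

(* The item at position p of the order [reorder] below, together with all items
   before it, comes after the first [threshold p] items of the original order. *)
Definition threshold p : nat :=
  (if p < v then 3 * B else 3 * (B - 1 - (p - v) %/ 2))%N.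

Lemma threshold_le p : (threshold p <= 3 * B)%N.
Proof. rewrite /threshold; case: ifP => ?; lia. Qed.

Lemma threshold_lt p : (p < v + 2 * B)%N -> (threshold p + p < n)%N.
Proof. rewrite nE /threshold; case: ifP => ?; lia. Qed.

Lemma dvdn_threshold p : (3 %| threshold p)%N.
Proof. by rewrite /threshold; case: ifP => ?; rewrite dvdn_mulr. Qed.

Variable r : nat.
Hypothesis r3 : (r < 3)%N.

(* The first 3B positions form K and the last v positions form J; the new order
   lists J, then the positions of K outside the residue class r triple by triple
   in reverse, then the residue class r. *)
Definition reorder p : nat :=
  (if p < v then 3 * B + p
   else if p < v + 2 * B then 3 * (B - 1 - (p - v) %/ 2) + (r + 1 + (p - v) %% 2) %% 3
   else 3 * (p - v - 2 * B) + r)%N.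

Lemma reorder_lt p : (p < n)%N -> (reorder p < n)%N.
Proof. rewrite nE /reorder; do !case: ifP => ?; lia. Qed.

Lemma reorder_inj p q : (p < n)%N -> (q < n)%N -> reorder p = reorder q -> p = q.
Proof. rewrite nE /reorder; do !case: ifP => ?; lia. Qed.

Lemma reorder_ge p q : (p <= q)%N -> (q < v + 2 * B)%N ->
  (threshold q <= reorder p)%N.
Proof. rewrite /threshold /reorder => pq qv; do !case: ifP => ?; lia. Qed.

Lemma reorder_last k : reorder (v + 2 * B + k) = (3 * k + r)%N.
Proof. rewrite /reorder; do !case: ifP => ?; lia. Qed.

Definition reordered := [seq e_ (reorder p) | p <- iota 0 n].
Local Notation z := reordered.

Lemma size_reordered : size z = n. Proof. by rewrite size_map size_iota. Qed.

Lemma nth_reordered p : (p < n)%N -> nth x0 z p = e_ (reorder p).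
Proof. by move=> pn; rewrite (nth_map 0) ?size_iota // nth_iota. Qed.

Lemma uniq_map_e (l : seq nat) : uniq l -> {in l, forall i, i < n}%N ->
  uniq (map e_ l).
Proof.
move=> ul ln; rewrite map_inj_in_uniq // => i k /ln ilt /ln klt /eqP.
by rewrite nth_uniq ?size_e ?enum_uniq // => /eqP.
Qed.

Lemma uniq_reordered : uniq z.
Proof.
rewrite /z -[fun p => _]/(e_ \o reorder) map_comp; apply: uniq_map_e.
  rewrite map_inj_in_uniq ?iota_uniq // => i k.
  by rewrite !mem_iota /= add0n; apply: reorder_inj.
by move=> i /mapP[p]; rewrite mem_iota /= add0n => /reorder_lt ? ->.
Qed.

(** A normal form free of [reorder]: the [p] items after position [m] stand in for the reordered
    prefix, so the three values of [r] can be compared over the same set. *)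
Definition mod3_marginal m p : R := \sum_(s : {perm N})
  MG f (run (map s (take p (drop m.+1 e))) :|: run_mod3 r (map s (take m e)))
     (o (s (e_ m))).

(** By [reorder_ge], the first [threshold p] original items, the item at new position [p] and the
    new prefix form a list without repetition, hence exchangeable with an initial segment of [e]. *)
Lemma mod3_marginalE p : (p < v + 2 * B)%N ->
  \sum_(s : {perm N}) MG f (run (map s (take p z))
      :|: run_mod3 r (map s (take (threshold p) e))) (o (s (nth x0 z p)))
  = mod3_marginal (threshold p) p.
Proof.
move=> pv; set m := threshold p.
have mpn : (m + p < n)%N by apply: threshold_lt.
have pn : (p < n)%N by lia.
have sm : size (take m e) = m by rewrite size_take_min size_e; lia.
pose F w := MG f (run (drop m.+1 w) :|: run_mod3 r (take m w)) (o (nth x0 w m)).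
have FE i t (s : {perm N}) :
    MG f (run (map s t) :|: run_mod3 r (map s (take m e))) (o (s i))
    = F (map s (take m e ++ i :: t)).
  rewrite /F map_cat take_size_cat ?size_map // nth_cat size_map sm ltnn subnn /=.
  by rewrite drop_cat size_map sm ltnNge leqnSn /= subSnn /= drop0.
under eq_bigr do rewrite FE.
rewrite /mod3_marginal; under [RHS]eq_bigr do rewrite FE.
apply: sum_perm_map; last 1 first.
- by rewrite !size_cat /= !size_take_min size_drop size_reordered size_e; lia.
- rewrite nth_reordered // /z -map_take take_iota.
  have -> : take m e = map e_ (iota 0 m).
    by apply: (@eq_from_nth _ x0) => [|i]; rewrite ?size_map ?size_iota ?sm // => im;
       rewrite nth_take // (nth_map 0) ?size_iota // nth_iota.
  have -> : minn p n = p by lia.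
  rewrite (_ : [seq _ | _ <- iota 0 p] = map e_ (map reorder (iota 0 p))); last first.
    by rewrite -map_comp.
  rewrite -map_cons -map_cons -map_cat.
  have lP i : i \in p :: iota 0 p -> (i <= p)%N.
    by rewrite inE mem_iota add0n => /orP[/eqP->//|]; lia.
  apply: uniq_map_e.
    rewrite cat_uniq iota_uniq andTb; apply/andP; split; last first.
      rewrite map_inj_in_uniq.
        by rewrite cons_uniq iota_uniq mem_iota; lia.
      by move=> i k /lP ip /lP kp; apply: reorder_inj; lia.
    apply/hasPn => i /mapP[k /lP kp ->]; rewrite mem_iota add0n /= -leqNgt.
    exact: reorder_ge.
  move=> i; rewrite mem_cat mem_iota => /orP[|/mapP[k /lP kp ->]]; first by lia.
  by apply: reorder_lt; lia.
- apply: (@subseq_uniq _ _ e); last exact: enum_uniq.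
  rewrite -[subseq _ e](congr1 (subseq _) (cat_take_drop m e)).
  rewrite (drop_nth x0 (_ : (m < size e)%N)); last by rewrite size_e; lia.
  by apply: cat_subseq => //=; rewrite eqxx take_subseq.
Qed.

(** The optimum is covered by the reordered run [A] together with the class [C] of the original run.
    From position [q] on, [C] is ignored in bounding the marginals. *)
Lemma single_run q : (q <= v + 2 * B)%N ->
  Q <= g n + (g n - g (v + 2 * B)) + \sum_(q <= p < n) x p
       + \sum_(0 <= p < q) mod3_marginal (threshold p) p.
Proof.
move=> qv.
have qn : (q <= n)%N by lia.
pose A (s : {perm N}) := run (map s z).
pose C (s : {perm N}) := run_mod3 r (map s (take (3 * B) e)).
have uz (s : {perm N}) : uniq (map s z).
  by rewrite map_inj_uniq ?uniq_reordered //; apply: perm_inj.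
have szs (s : {perm N}) : size (map s z) = n by rewrite size_map size_reordered.
(* The items of [C] are the last [B] of the reordered run, and [greedy_alt] bounds the marginal of
   each choice in [C] by the gain made there on the same item. *)
have AC s : f (A s :|: C s) <= f (A s) + (f (A s) - f (run (map s (take (v + 2 * B) z)))).
  apply: le_trans (le_setU_seq f_val _ _) _; rewrite lerD2l big_map.
  have -> : f (A s) = f (run (take (v + 2 * B + B) (map s z))).
    by rewrite take_oversize // szs; lia.
  rewrite (map_take _ _ z).
  have /= <- := telescope_sumr (fun k => f (run (take k (map s z))))
    (leq_addr B (v + 2 * B)%N).
  rewrite -{1}[(v + 2 * B)%N]add0n big_addn addKn.
  have -> : (size (map s (take (3 * B) e)) %/ 3)%N = B.
    by rewrite size_map size_take_min size_e; lia.
  rewrite /index_iota subn0 !big_seq; apply: ler_sum => k.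
  rewrite mem_iota add0n => /andP[_ kB].
  have pn : (k + (v + 2 * B) < n)%N by lia.
  rewrite (take_nth x0) ?szs // run_rcons.
  apply: le_trans (MG_anti f_val _ (run_take_subT _ _ _ (k + (v + 2 * B)))) _.
  rewrite {1}/choice.
  have -> : nth x0 (map s (take (3 * B) e)) (3 * k + r)
      = nth x0 (map s z) (k + (v + 2 * B)).
    rewrite !(nth_map x0) ?size_reordered ?size_take_min ?size_e; try lia.
    rewrite nth_reordered // nth_take; last by lia.
    by rewrite (addnC k) reorder_last.
  apply: greedy_alt.
  by rewrite -take_nth ?szs // take_uniq.
apply: (@le_trans _ _ (\sum_(s : {perm N})
   (f (A s) + (f (A s) - f (run (map s (take (v + 2 * B) z))))
   + \sum_(0 <= p < n) MG f (A s :|: C s) (o (s (nth x0 z p)))))).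
  apply: ler_sum => s _; apply: le_trans (opt_le_cover (A s :|: C s) (uz s) (szs s)) _.
  apply: lerD => //; rewrite !big_nat; apply: ler_sum => p /andP[_ pn].
  by rewrite (nth_map x0) ?size_reordered.
have gE k : (k <= n)%N -> \sum_(s : {perm N}) f (run (map s (take k z))) = g k.
  move=> kn; rewrite total_valueE ?take_uniq ?uniq_reordered //.
  by rewrite size_take_min size_reordered; congr g; lia.
rewrite big_split /= big_split /= sumrB gE; last by lia.
have -> : \sum_(s : {perm N}) f (A s) = g n.
  by rewrite -(gE n) //; apply: eq_bigr => s _; rewrite take_oversize ?size_reordered.
rewrite -[leRHS]addrA lerD2l exchange_big /= [leRHS]addrC (big_cat_nat (leq0n q) qn) /=.
apply: lerD; rewrite !big_nat; apply: ler_sum => p /andP[qp pq].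
  rewrite -mod3_marginalE; last by lia.
  apply: ler_sum => s _; apply: MG_anti => //; apply: setUSS.
    by rewrite map_take; apply: run_take_subT.
  (* Only the part of the class before [threshold p] is kept; divisibility by 3 keeps the triples
     whole. *)
  have := threshold_le p; have := dvdn_threshold p; move=> T3 TB.
  rewrite -(take_takel _ TB) map_take; exact: run_mod3_take_sub.
rewrite -[x p](_ : \sum_(s : {perm N}) MG f (run (map s (take p z))) (o (s (nth x0 z p))) = _).
  apply: ler_sum => s _; apply: MG_anti => //; apply: subsetU; apply/orP; left.
  by rewrite map_take; apply: run_take_subT.
rewrite total_marginalE; last by rewrite -take_nth ?size_reordered // take_uniq ?uniq_reordered.
by rewrite size_take_min size_reordered (minn_idPl (ltnW pq)).
Qed.

End Reordering.

(* Second-order supermodularity enters here: over Y, the damages of the three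
   residue classes of a run add up to at least the damage of the whole run. *)
Lemma sum_mod3_marginal m p : (3 %| m)%N -> (m + p < n)%N ->
  mod3_marginal 0 m p + mod3_marginal 1 m p + mod3_marginal 2 m p
  <= 2 * x p + x m.
Proof.
move=> m3 mpn.
have ut : uniq (rcons (take p (drop m.+1 e)) (e_ m)).
  rewrite rcons_uniq take_uniq ?drop_uniq ?enum_uniq // andbT.
  apply/negP => /mem_take.
  have := enum_uniq N; rewrite -{1}(cat_take_drop m e) (drop_nth x0) ?size_e; last by lia.
  by rewrite cat_uniq /= => /and3P[_ _ /andP[/negP]].
have <- : \sum_(s : {perm N}) MG f (run (map s (take p (drop m.+1 e)))) (o (s (e_ m))) = x p.
  rewrite (total_marginalE ut) size_take_min size_drop size_e; congr x; lia.
rewrite /mod3_marginal -!big_split /= mulr_sumr -big_split; apply: ler_sum => s _ /=.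
set Y := run (map s (take p _)); set t := map s (take m e).
have := MG_setU2 f_val f_sos Y (run_mod3 0 t) (run_mod3 1 t) (o (s (e_ m))).
have := MG_setU2 f_val f_sos Y (run_mod3 0 t :|: run_mod3 1 t) (run_mod3 2 t) (o (s (e_ m))).
have : run t \subset Y :|: (run_mod3 0 t :|: run_mod3 1 t) :|: run_mod3 2 t.
  apply: subset_trans (run_sub_mod3 _ _ _) _.
    by rewrite size_map size_take_min size_e (_ : minn _ _ = m) //; lia.
  by rewrite -!setUA subsetUr.
move=> /(MG_anti f_val (o (s (e_ m)))); rewrite !setUA; lra.
Qed.

(** Two positions share each threshold [3 * c + 3], where [x] is at most its mean over the three
    preceding positions; this gives the factor 2/3. *)
Lemma sum_threshold_le v B I : n = (v + 3 * B)%N -> (0 < v)%N -> (I < B)%N ->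
  \sum_(v <= p < v + 2 * I) x (threshold v B p)
  <= 2 / 3 * (X (3 * B) - X (3 * (B - 1 - I))).
Proof.
move=> nE v0; elim: I => [|I IH] IB.
  rewrite muln0 addn0 big_geq //; apply: mulr_ge0; first lra.
  rewrite subr_ge0.
  rewrite (big_cat_nat (leq0n (3 * (B - 1 - 0))) (_ : _ <= 3 * B)%N) /=; last by lia.
  by rewrite lerDl; apply: sumr_ge0 => i _; apply: total_marginal_ge0.
have /IH {}IH : (I < B)%N by lia.
set c := (B - 1 - I.+1)%N.
have cE : (B - 1 - I = c.+1)%N by rewrite /c; lia.
have T2 k : (k < 2)%N -> threshold v B (v + 2 * I + k) = (3 * c).+3.
  by move=> k2; rewrite /threshold; case: ifP => ?; rewrite /c; lia.
have -> : (v + 2 * I.+1 = (v + 2 * I).+2)%N by lia.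
rewrite !big_nat_recr /=; try by lia.
have := T2 0 isT; have := T2 1 isT; rewrite addn0 addn1 => -> ->.
have c3n : ((3 * c).+3 < n)%N by rewrite nE /c; lia.
rewrite cE (_ : 3 * c.+1 = (3 * c).+3)%N in IH; last by lia.
rewrite (big_nat_recr (3 * c).+2) // (big_nat_recr (3 * c).+1) //
  (big_nat_recr (3 * c)%N) //= in IH.
have xc k : (k < 3)%N -> x (3 * c).+3 <= x (3 * c + k).
  by move=> k3; apply: total_marginal_anti; lia.
have := xc 0 isT; have := xc 1 isT; have := xc 2 isT.
rewrite addn0 addn1 addn2; lra.
Qed.

(** [single_run] is summed over the three classes. Before [q], position [p] then costs
    [2 * x p + x (threshold v B p)] in place of [3 * x p]. *)
Lemma three_runs v B I : n = (v + 3 * B)%N -> (0 < v)%N -> (I < B)%N ->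
  3 * Q <= 3 * (g n + (g n - g (v + 2 * B))) + 3 * X n - X (v + 2 * I)
     + v%:R * x (3 * B) + 2 / 3 * (X (3 * B) - X (3 * (B - 1 - I))).
Proof.
move=> nE v0 IB; set q := (v + 2 * I)%N.
have qv : (q <= v + 2 * B)%N by rewrite /q; lia.
have qn : (q <= n)%N by lia.
have := single_run nE (isT : 0 < 3)%N qv.
have := single_run nE (isT : 1 < 3)%N qv.
have := single_run nE (isT : 2 < 3)%N qv.
have XE : X n = X q + \sum_(q <= p < n) x p by rewrite (big_cat_nat (leq0n q) qn).
have : \sum_(0 <= p < q) mod3_marginal 0 (threshold v B p) p
     + \sum_(0 <= p < q) mod3_marginal 1 (threshold v B p) p
     + \sum_(0 <= p < q) mod3_marginal 2 (threshold v B p) p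
     <= 2 * X q + \sum_(0 <= p < q) x (threshold v B p).
  rewrite mulr_sumr -!big_split /= !big_nat; apply: ler_sum => p /andP[_ pq].
  apply: sum_mod3_marginal; first exact: dvdn_threshold.
  by apply: threshold_lt => //; apply: leq_trans qv.
have -> : \sum_(0 <= p < q) x (threshold v B p)
    = v%:R * x (3 * B) + \sum_(v <= p < q) x (threshold v B p).
  rewrite (big_cat_nat (leq0n v) (leq_addr (2 * I) v)) /=; congr (_ + _).
  rewrite big_nat (eq_bigr (fun=> x (3 * B))) => [|p /andP[_ pv]].
    by rewrite -big_nat sumr_const_nat subn0 mulr_natl.
  by rewrite /threshold pv.
have := sum_threshold_le nE v0 IB; rewrite -/q; lra.
Qed.

(* The positions 10L - 2, 12L, 15L, 18L (of 24L) were chosen to make the linear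
   combination good enough; the bound obtained tends to 0.5106 as L grows. *)
Lemma greedy_ratio L : n = (24 * L)%N -> (100 <= L)%N -> 319 / 625 * Q <= g n.
Proof.
move=> nE L100.
have := @three_runs (6 * L) (6 * L) (2 * L - 1).
rewrite (_ : 6 * L + 2 * (6 * L) = 18 * L)%N; last by lia.
rewrite (_ : 3 * (6 * L) = 18 * L)%N; last by lia.
rewrite (_ : 6 * L + 2 * (2 * L - 1) = 10 * L - 2)%N; last by lia.
rewrite (_ : 3 * (6 * L - 1 - (2 * L - 1)) = 12 * L)%N; last by lia.
have a1 : n = (6 * L + 18 * L)%N by lia.
have a2 : (0 < 6 * L)%N by lia.
have a3 : (2 * L - 1 < 6 * L)%N by lia.
move=> /(_ a1 a2 a3).
(* As [x] decreases, [x (18 * L)] is at most its mean over the [3 * L] positions before it. *)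
have tail : (6 * L)%:R * x (18 * L) <= 2 * (X (18 * L) - X (15 * L)).
  rewrite (big_cat_nat (leq0n (15 * L)) (_ : _ <= 18 * L)%N) /=; last by lia.
  rewrite addrAC subrr add0r.
  apply: (@le_trans _ _ (2 * \sum_(15 * L <= i < 18 * L) x (18 * L))).
    rewrite sumr_const_nat -[x _ *+ _]mulr_natl mulrA -natrM ler_wpM2r ?total_marginal_ge0 //.
    by rewrite ler_nat; lia.
  rewrite ler_pM2l // !big_nat; apply: ler_sum => i ?; apply: total_marginal_anti; lia.
have n1 : (1 < n)%N by lia.
have L0 : L%:R != 0 :> R by rewrite pnatr_eq0; lia.
have lb p k : (p <= n)%N -> (n - p = k * L)%N ->
    Q * (1 - (k%:R / 24) ^+ 2) <= g p + X p.
  move=> pn kE; have := potential_lb pn n1.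
  rewrite kE nE !natrM (_ : k%:R * L%:R / _ = k%:R / 24%:R) //.
  by field; rewrite ?L0 ?pnatr_eq0.
have Q0 : 0 <= Q by apply: sumr_ge0 => s _; case: f_val.
(* [117 / 200] lies slightly above the limit 7/12 of [(14 * L + 2) / (24 * L)] and bounds this
   fraction once [50 <= L]. *)
have lb0 : Q * (1 - (117 / 200) ^+ 2) <= g (10 * L - 2) + X (10 * L - 2).
  have pn : (10 * L - 2 <= n)%N by lia.
  apply: le_trans (potential_lb pn n1); apply: ler_wpM2l => //.
  rewrite lerD2l lerN2 lerXn2r ?nnegrE ?divr_ge0 ?ler0n //.
  rewrite ler_pdivrMr ?ltr0n; last by lia.
  rewrite mulrAC ler_pdivlMr ?ltr0n // -!natrM ler_nat; lia.
have lb12 := lb (12 * L)%N 12%N ltac:(lia) ltac:(lia).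
have lb15 := lb (15 * L)%N 9%N ltac:(lia) ltac:(lia).
have lb18 := lb (18 * L)%N 6%N ltac:(lia) ltac:(lia).
have XG p q : (p <= q <= n)%N -> X q - X p <= g q - g p.
  exact: sum_marginal_le_value.
have := XG (10 * L - 2)%N (18 * L)%N ltac:(lia).
have := XG (12 * L)%N (18 * L)%N ltac:(lia).
have := XG (15 * L)%N (18 * L)%N ltac:(lia).
have := XG (18 * L)%N n ltac:(lia).
have := XG 0%N (18 * L)%N ltac:(lia); rewrite (@big_geq _ _ _ 0 0) //.
have := total_value_ge0 0.
lra.
Qed.

End Greedy.

(** * Reduction of welfare to one function on item-agent pairs, with worthless items added *)

Section Padding.
Context {R : realType} {N M : finType} (v : M -> {set N} -> R) (d : nat).
Hypothesis v_val : forall l, valuation (v l).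
Hypothesis v_sos : forall l, second_order_supermodular (v l).
Local Notation N' := (N + 'I_d)%type.
Implicit Types (S : {set N' * M}) (l : M) (h : seq N').

Definition slice S l : {set N} := [set j | (inl j, l) \in S].

Definition pair_welfare S : R := \sum_l v l (slice S l).
Local Notation f := pair_welfare.

Lemma sliceU S S' l : slice (S :|: S') l = slice S l :|: slice S' l.
Proof. by apply/setP=> j; rewrite !inE. Qed.

Lemma sliceI S S' l : slice (S :&: S') l = slice S l :&: slice S' l.
Proof. by apply/setP=> j; rewrite !inE. Qed.

Lemma sliceS S S' l : S \subset S' -> slice S l \subset slice S' l.
Proof. by move=> /subsetP sSS'; apply/subsetP=> j; rewrite !inE => /sSS'. Qed.

Lemma slice_disjoint S S' l :
  [disjoint S & S'] -> [disjoint slice S l & slice S' l].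
Proof.
rewrite -!setI_eq0 -sliceI => /eqP->.
by apply/eqP/setP => j; rewrite !inE.
Qed.

Lemma slice_setU1 (j : N) (l l' : M) S :
  slice ((inl j, l) |: S) l' = if l' == l then j |: slice S l' else slice S l'.
Proof. by apply/setP => i; case: ifP => ll; rewrite !inE xpair_eqE ll ?andbT ?andbF. Qed.

Lemma slice_setU1_dummy (k : 'I_d) (l l' : M) S :
  slice ((inr k, l) |: S) l' = slice S l'.
Proof. by apply/setP => i; rewrite !inE xpair_eqE. Qed.

Lemma MG_pair_welfare S (j : N) l : MG f S (inl j, l) = MG (v l) (slice S l) j.
Proof.
rewrite /MG /f (bigD1 l) //= [X in _ - X](bigD1 l) //= slice_setU1 eqxx.
rewrite (eq_bigr (fun l' => v l' (slice S l'))) => [|l' /negPf ll']; first by ring.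
by rewrite slice_setU1 ll'.
Qed.

Lemma MG_pair_welfare_dummy S (k : 'I_d) l : MG f S (inr k, l) = 0.
Proof.
by rewrite /MG /f; under eq_bigr do rewrite slice_setU1_dummy; rewrite subrr.
Qed.

Lemma pair_welfare_valuation : valuation f.
Proof.
split.
- by move=> S; apply: sumr_ge0 => l _; case: (v_val l).
- apply: big1 => l _; case: (v_val l) => _ v0 _ _.
  by rewrite (_ : slice _ _ = finset.set0) //; apply/setP => j; rewrite !inE.
- move=> S S' sSS'; apply: ler_sum => l _; case: (v_val l) => _ _ vM _.
  exact/vM/sliceS.
- move=> S S'; rewrite /f -!big_split; apply: ler_sum => l _ /=.
  by case: (v_val l) => _ _ _; rewrite sliceU sliceI.
Qed.

Lemma pair_welfare_sos : second_order_supermodular f.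
Proof.
move=> S S' C [[j|k] l] sSS' dC; last by rewrite !MG_pair_welfare_dummy.
rewrite !MG_pair_welfare !sliceU; apply: v_sos; first exact: sliceS.
exact: slice_disjoint.
Qed.

Context (alg : @online_rule N M) (a : N -> M) (m0 : M).
Hypothesis alg_greedy : greedy v alg.

Definition unpad h : seq N := pmap (fun y => if y is inl j then Some j else None) h.

Definition padded_alg h (y : N') : N' * M :=
  (y, if y is inl j then alg (unpad h) j else m0).

Definition padded_opt (y : N') : N' * M := (y, if y is inl j then a j else m0).

Lemma mem_unpad h j : (j \in unpad h) = (inl j \in h).
Proof.
by elim: h => [|[i|k] h IH] //=; rewrite !inE ?IH.
Qed.

Lemma unpad_rcons h y :
  unpad (rcons h y) = if y is inl j then rcons (unpad h) j else unpad h.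
Proof. by rewrite -cats1 /unpad pmap_cat; case: y => [j|k] /=; rewrite ?cats1 ?cats0. Qed.

Lemma uniq_unpad h : uniq h -> uniq (unpad h).
Proof.
elim: h => [|[j|k] h IH] //= /andP[yh /IH ->] //.
by rewrite -/(unpad h) mem_unpad yh.
Qed.

Lemma bundle_rcons (h : seq N) j l : uniq (rcons h j) ->
  bundle alg (rcons h j) l = if l == alg h j then j |: bundle alg h l else bundle alg h l.
Proof.
rewrite rcons_uniq => /andP[jh _]; apply/setP => i.
have jE : index j (rcons h j) = size h by rewrite -cats1 index_cat (negPf jh) /= eqxx addn0.
have -> : (i \in (if l == alg h j then j |: bundle alg h l else bundle alg h l))
    = (i == j) && (l == alg h j) || (i \in bundle alg h l).
  by case: ifP; rewrite ?andbT ?andbF // !inE.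
rewrite !inE mem_rcons inE; have [->|ij] := eqVneq i j.
  by rewrite (negPf jh) jE -cats1 take_size_cat //= orbF eq_sym.
rewrite /=; case: (boolP (i \in h)) => //= ih.
by rewrite -cats1 index_cat ih takel_cat // ltnW // index_mem.
Qed.

Lemma slice_run (y0 : N') h l : uniq h ->
  slice (run y0 padded_alg h) l = bundle alg (unpad h) l.
Proof.
elim/last_ind: h => [|h y IH] uh; first by apply/setP => j; rewrite !inE.
have /IH {}IH : uniq h by move: uh; rewrite rcons_uniq => /andP[].
have := uniq_unpad uh; rewrite run_rcons unpad_rcons; case: y uh => [j|k] uh uj.
  by rewrite slice_setU1 bundle_rcons // IH.
by rewrite slice_setU1_dummy.
Qed.

Lemma padded_greedy (y0 : N') h y l : uniq (rcons h y) ->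
  MG f (run y0 padded_alg h) (y, l) <= MG f (run y0 padded_alg h) (padded_alg h y).
Proof.
move=> uhy; have uh : uniq h by move: uhy; rewrite rcons_uniq => /andP[].
have := uniq_unpad uhy; rewrite unpad_rcons /padded_alg.
case: y uhy => [j|k] _ uj; last by rewrite !MG_pair_welfare_dummy.
by rewrite !MG_pair_welfare !slice_run //; apply: alg_greedy.
Qed.

Lemma pair_welfare_opt :
  f [set padded_opt y | y : N'] = welfare v (fun l => [set j | a j == l]).
Proof.
apply: eq_bigr => l _; congr (v l _); apply/setP => j; rewrite !inE.
apply/imsetP/eqP => [[[i|k] _ []]|<-]; last by exists (inl j).
- by move=> -> ->.
- by [].
Qed.

(** The genuine items of a random padded order are themselves in random order. Both sides equal a
    double sum over [s] and [t]: for fixed [s], translate [t] by the extension of [s]; for fixed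
    [t], the genuine items form an enumeration of [N]. *)
Lemma sum_unpad (F : seq N -> R) :
  #|{perm N}|%:R * \sum_(s : {perm N'}) F (unpad (map s (enum {: N'})))
  = #|{perm N'}|%:R * \sum_(s : {perm N}) F (map s (enum N)).
Proof.
pose ext (s : {perm N}) (y : N') : N' := if y is inl j then inl (s j) else y.
have ext_inj s : injective (ext s).
  by move=> [i|i] [k|k] //= [/perm_inj->].
have extE (s : {perm N}) h : unpad (map (ext s) h) = map s (unpad h).
  by elim: h => [|[j|k] h IH] //=; rewrite -/(unpad _) IH.
transitivity (\sum_(s : {perm N}) \sum_(t : {perm N'}) F (map s (unpad (map t (enum {: N'}))))).
  rewrite mulr_natl -sumr_const; apply: eq_bigr => s _.
  rewrite (reindex_inj (mulIg (perm (ext_inj s)))); apply: eq_bigr => t _.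
  rewrite -extE -(map_comp (ext s)); congr (F (unpad _)); apply: eq_map => y /=.
  by rewrite permM permE.
rewrite exchange_big mulr_natl -sumr_const; apply: eq_bigr => t _ /=.
have ut : uniq (map t (enum {: N'})) by rewrite map_inj_uniq ?enum_uniq //; apply: perm_inj.
apply: sum_perm_map; rewrite ?uniq_unpad ?enum_uniq //.
rewrite -cardE -(card_uniqP (uniq_unpad ut)); apply: eq_card => j.
rewrite mem_unpad (_ : inl j \in _ = true) //.
by apply/mapP; exists ((t^-1)%g (inl j)); rewrite ?permKV // mem_enum.
Qed.

Lemma padded_ratio L : (#|N| + d = 24 * L)%N -> (100 <= L)%N -> N ->
  319 / 625 * welfare v (fun l => [set j | a j == l]) <= expected_welfare v alg.
Proof.
move=> NE L100 j0.
have cE : #|{: N'}| = (24 * L)%N by rewrite card_sum card_ord.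
have := @greedy_ratio _ _ _ (inl j0) f padded_alg padded_opt
  pair_welfare_valuation pair_welfare_sos
  (fun h y => @padded_greedy _ h y _) (fun h h' y => @padded_greedy _ h y _) _ cE L100.
rewrite /total_opt /total_value pair_welfare_opt sumr_const -[_ *+ _]mulr_natl.
have P0 (K : finType) : 0 < #|{perm K}|%:R :> R.
  by rewrite ltr0n; apply/card_gt0P; exists 1%g.
have -> : \sum_(s : {perm N'})
      f (run (inl j0) padded_alg (map s (take #|{: N'}| (enum {: N'}))))
   = \sum_(s : {perm N'}) welfare v (bundle alg (unpad (map s (enum {: N'})))).
  apply: eq_bigr => s _; rewrite take_oversize -?cardE //; apply: eq_bigr => l _.
  by rewrite slice_run // map_inj_uniq ?enum_uniq //; apply: perm_inj.
rewrite -(ler_pM2l (P0 N)) (sum_unpad (fun t => welfare v (bundle alg t))).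
rewrite /expected_welfare ler_pdivlMr // => H.
rewrite -(ler_pM2l (P0 {: N'})); apply: le_trans H.
by rewrite le_eqVlt; apply/orP; left; apply/eqP; ring.
Qed.

End Padding.

(** * From a fixed allocation to the competitive ratio *)

Lemma greedy_competitive (R : realType) (N M : finType) (v : M -> {set N} -> R)
    (alg : @online_rule N M) :
  (forall l, valuation (v l)) -> (forall l, second_order_supermodular (v l)) ->
  greedy v alg -> 319 / 625 * OPT v <= expected_welfare v alg.
Proof.
move=> v_val v_sos alg_greedy.
have E0 : 0 <= expected_welfare v alg.
  rewrite divr_ge0 ?ler0n //; apply: sumr_ge0 => s _; apply: sumr_ge0 => l _.
  by case: (v_val l).
rewrite mulrC -ler_pdivlMr; last by lra.
apply: bigmax_le => [|a _]; first by rewrite divr_ge0 //; lra.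
rewrite ler_pdivlMr; last by lra.
rewrite mulrC; case: (pickP (fun _ : N => true)) => [j0 _|N0].
  (* The padding brings the number of items to [24 * L] with [L = 100 + #|N|]; the dummies go to the
     arbitrary agent [a j0]. *)
  apply: (@padded_ratio _ _ _ v (24 * (100 + #|N|) - #|N|) v_val v_sos alg a
    (a j0) alg_greedy (100 + #|N|)) => //; lia.
rewrite /welfare big1 ?mulr0 // => l _; case: (v_val l) => _ v0 _ _.
by rewrite (_ : [set j | _] = finset.set0) //; apply/setP => j; have := N0 j.
Qed.

Lemma card_valuation (R : realType) (N : finType) :
  valuation (fun A : {set N} => #|A|%:R : R).
Proof.
split; rewrite ?cards0 //.
- by move=> A B sAB; rewrite ler_nat subset_leq_card.
- by move=> A B; rewrite -!natrD cardsUI.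
Qed.

Lemma card_sos (R : realType) (N : finType) :
  second_order_supermodular (fun A : {set N} => #|A|%:R : R).
Proof.
move=> A B S e sAB dSB.
have mgE C : MG (fun A : {set N} => #|A|%:R : R) C e = (e \notin C)%:R.
  by rewrite /MG cardsU1 natrD addrK.
rewrite !mgE !inE; have [eS|eS] := boolP (e \in S); last by rewrite !orbF !subrr.
have eB := disjointFr dSB eS.
by rewrite eB (contraFF (subsetP sAB e) eB).
Qed.

(* 0.5104 = 319 / 625 *)
Theorem theorem1p3 (R : realType) :
  319%:R / 625%:R <=
    greedy_competitive_ratio (fun N : finType => @second_order_supermodular R N).
Proof.
apply: lb_le_inf.
  (* One item and one agent valuing sets by cardinality show that the set of ratios is nonempty. *)
  pose v (_ : unit) (A : {set unit}) : R := #|A|%:R.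
  pose alg : @online_rule unit unit := fun _ _ => tt.
  exists (expected_welfare v alg / OPT v); exists unit, unit, v, alg; split => //.
  - by move=> l; split; [exact: card_valuation | exact: card_sos].
  - apply: lt_le_trans (le_bigmax _ _ [ffun=> tt]).
    rewrite /welfare (bigD1 tt) //= ltr_wpDr ?sumr_ge0 // ltr0n.
    by apply/card_gt0P; exists tt; rewrite inE ffunE.
move=> _ [N [M [v [alg [v_ok v_greedy OPT0 ->]]]]].
by rewrite ler_pdivlMr //; apply: greedy_competitive => // l; case: (v_ok l).
Qed.
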